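(* Let $k$ be even. A subgraph of $GG_{n,k}$ is a chained fully-packed loop configuration if and only if it contains the boundary edges between $v^{(\ell)}_{i,0}$ and $v^{(\ell)}_{i,1}$ whenever $i$ is odd and between $v^{(\ell)}_{0,j}$ and $v^{(\ell)}_{1,j}$ whenever $j$ is even, and its interior vertices are each adjacent to (that is, incident to) exactly two edges.
   Context: For positive integers $n,k$, $ASM^{\circ}_{n,k}$ (chained circular alternating sign matrices) is the set of $k$-tuples $(A^{(1)},\dots,A^{(k)})$ of $n\times n$ matrices with entries in $\{-1,0,1\}$ satisfying: (i) $\sum_{j=1}^m A^{(\ell)}_{i,j}\in\{0,1\}$ for all $1\le i,m\le n$, $1\le\ell\le k$; (ii) $\sum_{j=1}^n A^{(\ell-1)}_{i,j}+\sum_{j=1}^m A^{(\ell)}_{n+1-j,i}\in\{0,1\}$ for all $1\le i,m\le n$, $1\le\ell\le k$, where $A^{(0)}\equiv A^{(k)}$; (iii) the sum of all entries $\sum_{i,j,\ell}A^{(\ell)}_{i,j}$ is maximized (among all such $k$-tuples satisfying (i) and (ii)). Let $k$ be even. Superscripts are read cyclically modulo $k$. The chained grid graph $GG_{n,k}$ has interior vertices $v^{(\ell)}_{i,j}$ ($1\le i,j\le n$, $1\le\ell\le k$), boundary vertices $v^{(\ell)}_{0,j}$ and $v^{(\ell)}_{i,0}$ ($1\le i,j\le n$, $1\le\ell\le k$), and the following edges (for all $1\le\ell\le k$): - interior horizontal edges between $v^{(\ell)}_{i,j}$ and $v^{(\ell)}_{i,j+1}$, $1\le i\le n$, $1\le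 j<n$; - interior vertical edges between $v^{(\ell)}_{i,j}$ and $v^{(\ell)}_{i+1,j}$, $1\le i<n$, $1\le j\le n$; - chaining edges between $v^{(\ell)}_{i,n}$ and $v^{(\ell+1)}_{n,i}$, $1\le i\le n$, with $k+1\equiv 1$; - boundary edges between $v^{(\ell)}_{0,j}$ and $v^{(\ell)}_{1,j}$ and between $v^{(\ell)}_{i,0}$ and $v^{(\ell)}_{i,1}$, $1\le i,j\le n$. The chained ice configuration corresponding to $A\in ASM^{\circ}_{n,k}$ is the directed graph with underlying undirected graph $GG_{n,k}$ whose edges are directed as follows, for all $1\le\ell\le k/2$. (1) Interior horizontal edges ($1\le i\le n$, $1\le j<n$): $v^{(2\ell-1)}_{i,j}\leftarrow v^{(2\ell-1)}_{i,j+1}$ if $\sum_{j_0=1}^j A^{(2\ell-1)}_{i,j_0}=1$, and $v^{(2\ell-1)}_{i,j}\rightarrow v^{(2\ell-1)}_{i,j+1}$ if this sum is $0$; $v^{(2\ell)}_{i,j}\rightarrow v^{(2\ell)}_{i,j+1}$ if $\sum_{j_0=1}^j A^{(2\ell)}_{i,j_0}=1$, and $v^{(2\ell)}_{i,j}\leftarrow v^{(2\ell)}_{i,j+1}$ if this sum is $0$. (2) Interior vertical edges ($1\le i<n$, $1\le j\le n$): $v^{(2\ell-1)}_{i,j}\leftarrow v^{(2\ell-1)}_{i+1,j}$ if $\sum_{j_0=1}^n A^{(2\ell-2)}_{j,j_0}+\sum_{j_0=1}^{n-i}A^{(2\ell-1)}_{n+1-j_0,j}=1$, and $v^{(2\ell-1)}_{i,j}\rightarrow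 v^{(2\ell-1)}_{i+1,j}$ if this sum is $0$; $v^{(2\ell)}_{i,j}\rightarrow v^{(2\ell)}_{i+1,j}$ if $\sum_{j_0=1}^n A^{(2\ell-1)}_{j,j_0}+\sum_{j_0=1}^{n-i}A^{(2\ell)}_{n+1-j_0,j}=1$, and $v^{(2\ell)}_{i,j}\leftarrow v^{(2\ell)}_{i+1,j}$ if this sum is $0$. (3) Chaining edges ($1\le i\le n$): $v^{(2\ell-1)}_{i,n}\leftarrow v^{(2\ell)}_{n,i}$ if $\sum_{j_0=1}^n A^{(2\ell-1)}_{i,j_0}=1$, and $v^{(2\ell-1)}_{i,n}\rightarrow v^{(2\ell)}_{n,i}$ if this sum is $0$; $v^{(2\ell)}_{i,n}\rightarrow v^{(2\ell+1)}_{n,i}$ if $\sum_{j_0=1}^n A^{(2\ell)}_{i,j_0}=1$, and $v^{(2\ell)}_{i,n}\leftarrow v^{(2\ell+1)}_{n,i}$ if this sum is $0$. (4) Boundary edges ($1\le i,j\le n$): $v^{(2\ell-1)}_{i,0}\rightarrow v^{(2\ell-1)}_{i,1}$, $v^{(2\ell-1)}_{0,j}\leftarrow v^{(2\ell-1)}_{1,j}$, $v^{(2\ell)}_{i,0}\leftarrow v^{(2\ell)}_{i,1}$, $v^{(2\ell)}_{0,j}\rightarrow v^{(2\ell)}_{1,j}$. The vertex $v^{(\ell)}_{i,j}$ has parity equal to the parity of $i+j+\ell$. The chained fully-packed loop configuration corresponding to $A\in ASM^{\circ}_{n,k}$ is the undirected graph on the same vertices whose edges are the edges of the chained ice configuration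 of $A$ that are directed from an even vertex to an odd vertex. A chained fully-packed loop configuration is one that corresponds in this way to some $A\in ASM^{\circ}_{n,k}$.
   Formalization: ''Contains the boundary edges'' is read as containing exactly those boundary edges and no others; with extra boundary edges allowed the claim fails for n = 1, k = 2 (all four boundary edges, no chaining edges). *)

(* Defs.v *)
From HB Require Import structures.
From mathcomp Require Import all_boot all_order all_algebra.

Set Implicit Arguments.
Unset Strict Implicit.
Unset Printing Implicit Defensive.

Import Order.TTheory GRing.Theory Num.Theory.
Local Open Scope ring_scope.

(* Conventions.
   - Superscripts live in Z/k: the superscript l is represented by its residue
     in 'I_k, so l = k is the residue 0, and [ordS], [ord_pred] are
     the cyclic successor and predecessor.  For even k, [odd l] is the parity
     of the superscript.
   - Matrix indices and edge labels are 0-based ordinals, whereas the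
     coordinates of vertices are the 1-based naturals
     (with 0 for the boundary): the ordinal i stands for the index i.+1. *)

Section ChainedASM.
Variables n k : nat.

Implicit Types (A B : 'I_k -> 'M[int]_n) (l : 'I_k).

Definition row_psum A l (i : 'I_n) (m : nat) : int :=
  \sum_(j < n | (j < m)%N) A l i j.

(* The column is read from the bottom: [rev_ord j] is row n+1-j, 1-based. *)
Definition col_psum A l (i : 'I_n) (m : nat) : int :=
  \sum_(j < n | (j < m)%N) A l (rev_ord j) i.

Definition chained_psum A l (i : 'I_n) (m : nat) : int :=
  row_psum A (ord_pred l) i n + col_psum A l i m.

Definition prechained A : Prop :=
  [/\ forall l i j, A l i j \in [:: -1; 0; 1],
      forall l i m, (1 <= m <= n)%N -> row_psum A l i m \in [:: 0; 1]
    & forall l i m, (1 <= m <= n)%N -> chained_psum A l i m \in [:: 0; 1]].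

Definition total_sum A : int := \sum_l \sum_i \sum_j A l i j.

Definition chained_ASM A : Prop :=
  prechained A /\ forall B, prechained B -> total_sum B <= total_sum A.

End ChainedASM.

(* Edges are labelled rather than given as pairs of vertices: for k = 2 the
   chained grid graph has two parallel chaining edges between v^(1)_{n,n} and
   v^(2)_{n,n}. *)
Variant edge (k n : nat) : Type :=
  | Horizontal of 'I_k & 'I_n & 'I_n.-1
  | Vertical of 'I_k & 'I_n.-1 & 'I_n
  | Chain of 'I_k & 'I_n
  | Left of 'I_k & 'I_n
  | Top of 'I_k & 'I_n.

Section EdgeFinType.
Variables k n : nat.

Let code : Type :=
  ('I_k * 'I_n * 'I_n.-1) + ('I_k * 'I_n.-1 * 'I_n)
  + ('I_k * 'I_n) + ('I_k * 'I_n) + ('I_k * 'I_n).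

Definition edge_code (e : edge k n) : code :=
  match e with
  | Horizontal l i j => inl (inl (inl (inl (l, i, j))))
  | Vertical l i j => inl (inl (inl (inr (l, i, j))))
  | Chain l i => inl (inl (inr (l, i)))
  | Left l i => inl (inr (l, i))
  | Top l j => inr (l, j)
  end.

Definition edge_decode (c : code) : edge k n :=
  match c with
  | inl (inl (inl (inl (l, i, j)))) => Horizontal l i j
  | inl (inl (inl (inr (l, i, j)))) => Vertical l i j
  | inl (inl (inr (l, i))) => Chain l i
  | inl (inr (l, i)) => Left l i
  | inr (l, j) => Top l j
  end.

Lemma edge_codeK : cancel edge_code edge_decode.
Proof. by case. Qed.

HB.instance Definition _ := Finite.copy (edge k n) (can_type edge_codeK).

End EdgeFinType.

Section ChainedGrid.
Variables n k : nat.

(* (l, i, j) is v^(l)_{i,j}. *)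
Definition vertex : Type := 'I_k * nat * nat.

Definition interior (v : vertex) : bool :=
  let: (_, i, j) := v in (1 <= i <= n)%N && (1 <= j <= n)%N.

Definition ends (e : edge k n) : vertex * vertex :=
  match e with
  | Horizontal l i j => ((l, i.+1, j.+1), (l, i.+1, j.+2))
  | Vertical l i j => ((l, i.+1, j.+1), (l, i.+2, j.+1))
  | Chain l i => ((l, i.+1, n), (ordS l, n, i.+1))
  | Left l i => ((l, i.+1, 0%N), (l, i.+1, 1%N))
  | Top l j => ((l, 0%N, j.+1), (l, 1%N, j.+1))
  end.

(* A spanning subgraph of the chained grid graph is given by its edge set. *)
Definition degree (F : {set edge k n}) (v : vertex) : nat :=
  #|[set e in F | (v == (ends e).1) || (v == (ends e).2)]|.

Definition even_vertex (v : vertex) : bool :=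
  let: (l, i, j) := v in ~~ odd (i + j + l).

Implicit Type A : 'I_k -> 'M[int]_n.

(* Does the partial sum s direct an edge with superscript l from [(ends e).1]
   to [(ends e).2]?  (For A in ASM, s is 0 or 1.) *)
Definition sum_forward (l : 'I_k) (s : int) : bool :=
  if odd l then s == 0 else s == 1.

Definition forward A (e : edge k n) : bool :=
  match e with
  | Horizontal l i j => sum_forward l (row_psum A l i j.+1)
  | Vertical l i j => sum_forward l (chained_psum A l j (n - i.+1))
  | Chain l i => sum_forward l (row_psum A l i n)
  | Left l _ => odd l
  | Top l _ => ~~ odd l
  end.

(* The chained ice configuration of A, as the map from edges to pairs
   (tail, head). *)
Definition ice A (e : edge k n) : vertex * vertex :=
  if forward A e then ends e else ((ends e).2, (ends e).1).

Definition FPL_of A : {set edge k n} :=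
  [set e | even_vertex (ice A e).1 && ~~ even_vertex (ice A e).2].

Definition chained_FPL (F : {set edge k n}) : Prop :=
  exists2 A, chained_ASM A & F = FPL_of A.

(* "Contains the boundary edges ... whenever ..." prescribes which boundary edges
   are in F: with extra boundary edges allowed, the characterization fails
   already for n = 1, k = 2 (take all boundary edges and no chaining edge). *)
Definition FPL_boundary (F : {set edge k n}) : Prop :=
  (forall l (i : 'I_n), (Left l i \in F) = odd i.+1)
  /\ (forall l (j : 'I_n), (Top l j \in F) = ~~ odd j.+1).

End ChainedGrid.

(* Main.v *)
Require Import Defs.
From mathcomp Require Import all_boot all_order all_algebra.
From mathcomp Require Import zify.

Set Implicit Arguments.
Unset Strict Implicit.
Unset Printing Implicit Defensive.

Import Order.TTheory GRing.Theory Num.Theory.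
Local Open Scope ring_scope.

(** Matrices with prescribed partial sums, ice states and fully-packed loops are
the same data, edge by edge.

For a chained ASM [A], every edge of the grid carries a bit: a partial row sum
on a horizontal edge, a chained column sum on a vertical one. On a chaining
edge the two agree, since the column sums of A^(l) start from the full row sums
of A^(l-1). An entry of [A] is the difference of the bits on the two horizontal
edges at its vertex, and also of those on the two vertical ones; so the bits
satisfy a conservation law (the ice rule) at each interior vertex, and any bits
that satisfy it, with the right boundary values, come from exactly one matrix
tuple ([ice_states_saturated], [saturated_sums]).

The left boundary bit is an empty sum, hence 0. The top boundary bit is 1
because of maximality: the chained column sums of full length add up to twice
the total sum and are at most 1 each, so the total is at most n k / 2, and for
even k this bound is attained by identity matrices on the odd superscripts and
zero matrices on the even ones. Hence the maximizers are exactly the tuples all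
of whose full chained column sums are 1 ([chained_ASM_saturated]).

The parity of i + j + l alternates along every edge, including the chaining
edges around the cycle, because k is even. Reading off the directions, the
dependence on l cancels, and an edge belongs to the fully-packed loop
configuration iff its bit differs from the parity of i + j at its first end
([encodes_FPL]). At an interior vertex this flips the bits of one horizontal
and one vertical edge, those on the same side of the conservation law, so that
the law says precisely that two of the four incident edges are present; the
boundary bits become the prescribed boundary edges ([encodes_ice_states]). *)

(** * Partial sums and ice states *)

Section PartialSums.
Variables n k : nat.
Implicit Types (A B : 'I_k -> 'M[int]_n) (l : 'I_k).
Implicit Types h v : 'I_k -> 'I_n -> nat -> bool.

(** The bits of the edges of the grid: [h l i m] sits on the edge of row [i] just
after its first [m] vertices, and [v l j m] on the edge of column [j] just below
its top [m] vertices. The third clause identifies the two names of a chaining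
edge, and the last one is the conservation law at a vertex, written without
subtraction. *)
Definition ice_states h v : Prop :=
  [/\ forall l i, h l i 0 = false,
      forall l j, v l j 0 = true,
      forall l j, v l j n = h (ord_pred l) j n
    & forall l (i j : 'I_n), (h l i j.+1 + v l j i.+1 = h l i j + v l j i)%N].

(** Chained sums run from the bottom up, so the bit below the top [m] vertices
corresponds to [n - m] terms. *)
Definition has_sums A h v : Prop :=
  (forall l i m, (m <= n)%N -> row_psum A l i m = (h l i m : nat)%:Z)
  /\ (forall l j m, (m <= n)%N -> chained_psum A l j (n - m) = (v l j m : nat)%:Z).

Definition saturated A : Prop :=
  prechained A /\ forall l j, chained_psum A l j n = 1.

Lemma sum_ord_lt_recr (F : 'I_n -> int) (j : 'I_n) :
  \sum_(x < n | (x < j.+1)%N) F x = \sum_(x < n | (x < j)%N) F x + F j.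
Proof.
rewrite (bigD1 j) ?ltnS ?leqnn //= addrC; congr (_ + _).
by apply: eq_bigl => x; rewrite ltnS ltn_neqAle andbC.
Qed.

Lemma telescope_ord (f : nat -> int) m : (m <= n)%N ->
  \sum_(x < n | (x < m)%N) (f x.+1 - f x) = f m - f 0%N.
Proof.
move=> le_mn; rewrite -(big_ord_widen n (fun x => f x.+1 - f x) le_mn).
by rewrite -(big_mkord xpredT (fun x => f x.+1 - f x)) telescope_sumr.
Qed.

Lemma row_psum0 A l i : row_psum A l i 0 = 0.
Proof. exact: big_pred0. Qed.

Lemma col_psum0 A l i : col_psum A l i 0 = 0.
Proof. exact: big_pred0. Qed.

Lemma row_psumS A l (i j : 'I_n) :
  row_psum A l i j.+1 = row_psum A l i j + A l i j.
Proof. exact: sum_ord_lt_recr. Qed.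

Lemma col_psumS A l (i j : 'I_n) :
  col_psum A l j (n - i) = col_psum A l j (n - i.+1) + A l i j.
Proof.
by rewrite -subnSK // [LHS](sum_ord_lt_recr _ (rev_ord i)) rev_ordK.
Qed.

(** Each entry is counted once in its own column, and once through the row sum
that is passed on to the next superscript. *)
Lemma total_chained_psum A :
  \sum_l \sum_j chained_psum A l j n = total_sum A *+ 2.
Proof.
have all_lt (F : 'I_n -> int) : \sum_(x < n | (x < n)%N) F x = \sum_x F x.
  by apply: eq_bigl => x; rewrite ltn_ord.
under eq_bigr do rewrite big_split /=.
rewrite big_split mulr2n /=; congr (_ + _).
  rewrite [RHS](reindex_inj (can_inj (@ord_predK k))).
  by apply: eq_bigr => l _; apply: eq_bigr => i _; apply: all_lt.
apply: eq_bigr => l _; rewrite [RHS]exchange_big; apply: eq_bigr => j _.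
by rewrite [LHS]all_lt [RHS](reindex_inj rev_ord_inj).
Qed.

(** The horizontal differences of the bits define the entries; by the
conservation law the vertical differences give the same entries, so both the row
sums and the chained column sums telescope to the given bits. *)
Lemma ice_states_saturated h v :
  ice_states h v -> exists2 A, has_sums A h v & saturated A.
Proof.
case=> h0 v0 vn hv.
pose A l : 'M[int]_n :=
  \matrix_(i, j) ((h l i j.+1 : nat)%:Z - (h l i j : nat)%:Z).
have AE l i j : A l i j = (v l j i : nat)%:Z - (v l j i.+1 : nat)%:Z.
  by rewrite mxE; have := hv l i j; lia.
have rowE l i m : (m <= n)%N -> row_psum A l i m = (h l i m : nat)%:Z.
  move=> le_mn; rewrite /row_psum; under eq_bigr do rewrite mxE.
  by rewrite (telescope_ord (fun x => (h l i x : nat)%:Z)) // h0 subr0.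
have chE l j m : (m <= n)%N -> chained_psum A l j (n - m) = (v l j m : nat)%:Z.
  move=> le_mn; rewrite /chained_psum rowE // -vn /col_psum.
  under eq_bigr => x _ do rewrite AE /= subnSK //.
  rewrite (telescope_ord (fun x => (v l j (n - x)%N : nat)%:Z)) ?leq_subr //.
  by rewrite subn0 subKn // addrC subrK.
exists A; first by split.
split; last by move=> l j; rewrite -[X in chained_psum _ _ _ X]subn0 chE ?v0.
split=> [l i j | l i m /andP[_ le_mn] | l i m /andP[_ le_mn]].
- by rewrite mxE; case: (h _ _ _); case: (h _ _ _).
- by rewrite rowE //; case: (h _ _ _).
- by rewrite -(subKn le_mn) chE ?leq_subr //; case: (v _ _ _).
Qed.

Lemma saturated_sums A :
  saturated A -> exists2 hv, ice_states hv.1 hv.2 & has_sums A hv.1 hv.2.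
Proof.
case=> -[_ row01 ch01] sat.
pose h l i m := row_psum A l i m == 1.
pose v l j m := chained_psum A l j (n - m) == 1.
have boolE (x : int) : x \in [:: 0; 1] -> x = (x == 1 : nat)%:Z.
  by rewrite !inE => /orP[] /eqP->.
have rowE l i m : (m <= n)%N -> row_psum A l i m = (h l i m : nat)%:Z.
  case: m => [|m] le_mn; first by rewrite /h row_psum0.
  exact/boolE/row01.
have chE l j m : (m <= n)%N -> chained_psum A l j (n - m) = (v l j m : nat)%:Z.
  rewrite /v => le_mn; have [nm_eq0|nm_gt0] := posnP (n - m).
    (* A chained sum of length 0 is a full row sum of the previous matrix. *)
    rewrite nm_eq0 /chained_psum col_psum0 addr0.
    by apply/boolE/row01; rewrite leqnn (leq_ltn_trans _ (ltn_ord j)).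
  by apply/boolE/ch01; rewrite nm_gt0 leq_subr.
exists (h, v) => //=; split=> [l i | l j | l j | l i j].
- by rewrite /h row_psum0.
- by rewrite /v subn0 sat.
- by rewrite /v /h subnn /chained_psum col_psum0 addr0.
- have := chE l j i (ltnW (ltn_ord i)); have := chE l j _ (ltn_ord i).
  have := rowE l i j (ltnW (ltn_ord j)); have := rowE l i _ (ltn_ord j).
  by rewrite /chained_psum col_psumS row_psumS; lia.
Qed.

End PartialSums.

(** * The maximal total sum *)

Section Parity.
Variables (k : nat).
Hypothesis k_even : ~~ odd k.

Lemma odd_ordS (l : 'I_k) : odd (ordS l) = ~~ odd l.
Proof. by rewrite /= odd_mod //; apply/negbTE. Qed.

Lemma odd_ord_pred (l : 'I_k) : odd (ord_pred l) = ~~ odd l.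
Proof. by rewrite -{2}[l]ord_predK odd_ordS negbK. Qed.

End Parity.

(** The full chained sums are at most 1 and add up to twice the total sum, so a
saturated tuple is a maximizer; conversely, a maximizer reaches the total of any
saturated tuple, which forces every one of these sums to be 1. The parity
of [k] serves to exhibit a saturated tuple. *)
Lemma chained_ASM_saturated n k (k_even : ~~ odd k) (A : 'I_k -> 'M[int]_n) :
  chained_ASM A <-> saturated A.
Proof.
have ch_le1 (B : 'I_k -> 'M[int]_n) l j : prechained B -> chained_psum B l j n <= 1.
  case=> _ _ ch01; have := ch01 l j n; rewrite leqnn (leq_ltn_trans _ (ltn_ord j)) //.
  by rewrite !inE => /(_ isT)/orP[]/eqP->.
pose S (B : 'I_k -> 'M[int]_n) := \sum_l \sum_j chained_psum B l j n.
have le_S B C : S B <= S C -> total_sum B <= total_sum C.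
  by rewrite /S !total_chained_psum lerMn2r.
split=> [[preA maxA] | [preA satA]]; last first.
  split=> // B preB; apply: le_S.
  by apply: ler_sum => l _; apply: ler_sum => j _; rewrite satA ch_le1.
split=> //.
(* The bits of identity matrices on odd superscripts, zero on even ones. *)
pose h (l : 'I_k) (i : 'I_n) m := odd l && (i < m)%N.
pose v (l : 'I_k) (j : 'I_n) m := ~~ odd l || (m <= j)%N.
have [|B _ [preB satB]] := @ice_states_saturated n k h v.
  split=> [l i | l j | l j | l i j]; rewrite /h /v ?andbF ?orbT //.
    by rewrite odd_ord_pred // ltn_ord leqNgt ltn_ord andbT orbF.
  by case: (odd l) => //=; lia.
(* Total defect of A: nonpositive by maximality, yet a sum of nonnegative terms. *)
have def_le0 : \sum_l \sum_j (1 - chained_psum A l j n) <= 0.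
  have -> : \sum_l \sum_j (1 - chained_psum A l j n) = S B - S A.
    rewrite /S -sumrB; apply: eq_bigr => l _; rewrite -sumrB.
    by apply: eq_bigr => j _; rewrite satB.
  by rewrite subr_le0 /S !total_chained_psum lerMn2r maxA.
have def_ge0 l j : 0 <= 1 - chained_psum A l j n by rewrite subr_ge0 ch_le1.
have row_ge0 l : 0 <= \sum_j (1 - chained_psum A l j n) by apply: sumr_ge0.
have /eqP : \sum_l \sum_j (1 - chained_psum A l j n) = 0.
  by apply/eqP; rewrite eq_le def_le0 sumr_ge0.
rewrite psumr_eq0 // => /allP row_eq0 l j.
have := row_eq0 l (mem_index_enum l); rewrite /= psumr_eq0 // => /allP def_eq0.
have := def_eq0 j (mem_index_enum j).
by rewrite /= subr_eq0 => /eqP.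
Qed.

(** * Edges around a vertex *)

Section Edges.
Variables n k : nat.
Implicit Types (A : 'I_k -> 'M[int]_n) (l : 'I_k) (F : {set edge k n}).

(** The edge of row [i] after its first [m] vertices, for [m <= n]: a uniform name
for boundary, interior and chaining edges, so that vertex (l, i+1, j+1) always
lies between [hedge l i j] and [hedge l i j.+1]. *)
Definition hedge l (i : 'I_n) (m : nat) : edge k n :=
  if m is m'.+1 then
    if insub m' is Some j then Horizontal l i j else Chain l i
  else Left l i.

(** The analogue for columns, counted from the top. Column [j] ends at the bottom
in a chaining edge, which belongs to the previous superscript. *)
Definition vedge l (j : 'I_n) (m : nat) : edge k n :=
  if m is m'.+1 then
    if insub m' is Some i then Vertical l i j else Chain (ord_pred l) j
  else Top l j.

(** Reduces questions about incidence and coincidence of edges to arithmetic on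
their labels. *)
Lemma eq_hedge (e : edge k n) l i m :
  (e == hedge l i m) =
  match e with
  | Left l' i' => [&& l' == l, i' == i & m == 0%N]
  | Horizontal l' i' j => [&& l' == l, i' == i & m == j.+1]
  | Chain l' i' => [&& l' == l, i' == i & (n <= m)%N]
  | _ => false
  end.
Proof.
have lt_in := ltn_ord i.
case: m => [|m] /=; last case: insubP => [j _ <- | ge_m].
- by case: e => [? ? ?|? ? ?|? ?|? ?|? ?] //; apply/esym;
    rewrite ?andbF ?andbT // leqNgt (leq_ltn_trans _ lt_in) ?andbF.
- have lt_jn := ltn_ord j.
  case: e => [l' i' j'|? ? ?|? ?|? ?|? ?] //; rewrite ?andbF //.
    by rewrite andbA [_.+1 == _]eq_sym.
  by have -> : (n <= j.+1)%N = false; [lia | rewrite !andbF].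
- case: e => [l' i' j|? ? ?|? ?|? ?|? ?] //; rewrite ?andbF //.
  + by have -> : (m.+1 == j.+1) = false; [have := ltn_ord j; lia | rewrite !andbF].
  + by have -> : (n <= m.+1)%N; [lia | rewrite andbT].
Qed.

Lemma eq_vedge (e : edge k n) l j m :
  (e == vedge l j m) =
  match e with
  | Top l' j' => [&& l' == l, j' == j & m == 0%N]
  | Vertical l' i j' => [&& l' == l, j' == j & m == i.+1]
  | Chain l' j' => [&& l' == ord_pred l, j' == j & (n <= m)%N]
  | _ => false
  end.
Proof.
have lt_jn := ltn_ord j.
case: m => [|m] /=; last case: insubP => [i _ <- | ge_m].
- by case: e => [? ? ?|? ? ?|? ?|? ?|? ?] //; apply/esym;
    rewrite ?andbF ?andbT // leqNgt (leq_ltn_trans _ lt_jn) ?andbF.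
- have lt_in := ltn_ord i.
  case: e => [? ? ?|l' i' j'|? ?|? ?|? ?] //; rewrite ?andbF //.
    by rewrite [_.+1 == _]eq_sym andbA andbAC.
  by have -> : (n <= i.+1)%N = false; [lia | rewrite !andbF].
- case: e => [? ? ?|l' i j'|? ?|? ?|? ?] //; rewrite ?andbF //.
  + by have -> : (m.+1 == i.+1) = false; [have := ltn_ord i; lia | rewrite !andbF].
  + by have -> : (n <= m.+1)%N; [lia | rewrite andbT].
Qed.

Lemma vedge_chain l j : vedge l j n = hedge (ord_pred l) j n.
Proof.
have /eqP <- : Chain (ord_pred l) j == vedge l j n by rewrite eq_vedge !eqxx /=.
by apply/eqP; rewrite eq_hedge !eqxx /=.
Qed.

Lemma incident_edges l (i j : 'I_n) (e : edge k n) :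
  let v := (l, i.+1, j.+1) in
  (v == (ends e).1) || (v == (ends e).2)
  = (e \in [:: hedge l i j; hedge l i j.+1; vedge l j i; vedge l j i.+1]).
Proof.
have lt_in := ltn_ord i; have lt_jn := ltn_ord j.
rewrite !inE !eq_hedge !eq_vedge.
case: e => [l' i' j'|l' i' j'|l' i'|l' i'|l' j'] /=; rewrite !xpair_eqE.
- by have := ltn_ord j'; rewrite -!val_eqE /=; lia.
- by have := ltn_ord i'; rewrite -!val_eqE /=; lia.
- have -> : (l == ordS l') = (l' == ord_pred l).
    by apply/eqP/eqP => ->; rewrite ?ordSK ?ord_predK.
  by have := ltn_ord i'; rewrite [l == l']eq_sym -!val_eqE /=; lia.
- by rewrite -!val_eqE /=; lia.
- by rewrite -!val_eqE /=; lia.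
Qed.

(** A row and a column can only share a chaining edge, with superscripts [l] and
[ord_pred l], which differ because [k] is even; without this, for [k = 1], the
corner vertex would carry a loop. *)
Lemma uniq_incident_edges (k_even : ~~ odd k) l (i j : 'I_n) :
  uniq [:: hedge l i j; hedge l i j.+1; vedge l j i; vedge l j i.+1].
Proof.
(* Testing both equations against the constructors of a variable edge makes
   [eq_hedge] and [eq_vedge] reduce. *)
have neq (a b : edge k n) : (forall e, ~~ ((e == a) && (e == b))) -> a != b.
  by move=> /(_ a); rewrite eqxx.
have lt_in := ltn_ord i; have lt_jn := ltn_ord j.
have neq_pred : (l == ord_pred l) = false.
  by apply/negP=> /eqP /(congr1 (odd \o val)); rewrite /= odd_ord_pred //; case: odd.
have h_neq : hedge l i j != hedge l i j.+1.
  by apply: neq => e; rewrite !eq_hedge; case: e => // *; lia.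
have v_neq : vedge l j i != vedge l j i.+1.
  by apply: neq => e; rewrite !eq_vedge; case: e => // *; lia.
have hv_neq x y : hedge l i x != vedge l j y.
  apply: neq => e; rewrite eq_hedge eq_vedge; case: e => // [*|l' i'|*]; rewrite ?andbF //.
  by case: eqP => // ->; rewrite neq_pred andbF.
by rewrite !cons_uniq !inE !negb_or h_neq v_neq !hv_neq.
Qed.

Lemma degree_interior (k_even : ~~ odd k) F l (i j : 'I_n) :
  degree F (l, i.+1, j.+1)
  = ((hedge l i j \in F) + (hedge l i j.+1 \in F)
     + (vedge l j i \in F) + (vedge l j i.+1 \in F))%N.
Proof.
pose s := [:: hedge l i j; hedge l i j.+1; vedge l j i; vedge l j i.+1].
have -> : degree F (l, i.+1, j.+1) = #|[set e in filter (mem F) s]|.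
  congr #|pred_of_set _|.
  by apply/setP=> e; rewrite !inE mem_filter incident_edges.
rewrite cardsE (card_uniqP _) ?filter_uniq ?uniq_incident_edges //.
by rewrite size_filter /= addn0 !addnA.
Qed.

(** * Fully-packed loops and ice states *)

(** The parity is that of i + j at the first end of the edge; the superscript does
not enter, since changing its parity reverses both the direction attached to a bit
and the parity of the vertices. *)
Definition encodes F (h v : 'I_k -> 'I_n -> nat -> bool) : Prop :=
  (forall l i m, (m <= n)%N -> (hedge l i m \in F) = h l i m (+) odd (i + m).+1)
  /\ (forall l j m, (m <= n)%N -> (vedge l j m \in F) = v l j m (+) odd (m + j).+1).

Lemma edge_hv_ind (P : edge k n -> Prop) :
    (forall l i m, (m <= n)%N -> P (hedge l i m)) ->
    (forall l j m, (m <= n)%N -> P (vedge l j m)) ->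
  forall e, P e.
Proof.
move=> Ph Pv; case=> [l i j|l i j|l i|l i|l j].
- have /eqP -> : Horizontal l i j == hedge l i j.+1 by rewrite eq_hedge !eqxx.
  by apply: Ph; have := ltn_ord j; lia.
- have /eqP -> : Vertical l i j == vedge l j i.+1 by rewrite eq_vedge !eqxx.
  by apply: Pv; have := ltn_ord i; lia.
- have /eqP -> : Chain l i == hedge l i n by rewrite eq_hedge !eqxx /=.
  exact: Ph.
- exact: (Ph l i 0%N).
- exact: (Pv l j 0%N).
Qed.

Lemma encodes_inj F G h v : encodes F h v -> encodes G h v -> F = G.
Proof.
move=> [hF vF] [hG vG]; apply/setP; apply: edge_hv_ind => l i m le_mn.
  by rewrite hF ?hG.
by rewrite vF ?vG.
Qed.

(** On chaining edges it is the superscript that alternates, also from [k - 1] to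
0 because [k] is even. *)
Lemma even_vertex_ends (k_even : ~~ odd k) (e : edge k n) :
  even_vertex (ends e).2 = ~~ even_vertex (ends e).1.
Proof.
case: e => [l i j|l i j|l i|l i|l j]; rewrite /= !oddD.
- by rewrite /=; case: (odd i); case: (odd j); case: (odd l).
- by rewrite /=; case: (odd i); case: (odd j); case: (odd l).
- by rewrite odd_mod ?(negbTE k_even) //=; case: (odd i); case: (odd n); case: (odd l).
- by rewrite /=; case: (odd i); case: (odd l).
- by rewrite /=; case: (odd j); case: (odd l).
Qed.

(** As the ends have opposite parities, being directed from even to odd only
depends on the parity of the first end. *)
Lemma mem_FPL_of (k_even : ~~ odd k) A e :
  (e \in FPL_of A) = (forward A e == even_vertex (ends e).1).
Proof.
rewrite inE /ice; case: (forward A e) => /=; rewrite even_vertex_ends //;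
  by case: even_vertex.
Qed.

Lemma sum_forward_bool l (b : bool) : sum_forward l (b : nat)%:Z = odd l (+) b.
Proof. by rewrite /sum_forward; case: odd; case: b. Qed.

(** On interior and chaining edges the parity of the superscript occurs both in the
direction and in the vertex parity, and cancels. On boundary edges the fixed
direction is the one that the bits 0 (left) and 1 (top) would give. *)
Lemma encodes_FPL (k_even : ~~ odd k) A h v :
  ice_states h v -> has_sums A h v -> encodes (FPL_of A) h v.
Proof.
case=> h0 v0 vn _ [rowE chE].
have chainE l i : (Chain l i \in FPL_of A) = h l i n (+) odd (i + n).+1.
  rewrite mem_FPL_of //= rowE // sum_forward_bool !oddD /=.
  by case: (h _ _ _); case: (odd l); case: (odd i); case: (odd n).
split=> l i [|m] le_mn.
- by rewrite mem_FPL_of //= h0 !oddD; case: (odd l); case: (odd i).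
- rewrite /hedge; case: insubP => [j _ jE|ge_m].
    rewrite mem_FPL_of //= jE rowE // sum_forward_bool !oddD /= -jE.
    by case: (h _ _ _); case: (odd l); case: (odd i); case: (odd j).
  by have -> : m.+1 = n by (have := ltn_ord i; lia).
- by rewrite mem_FPL_of //= v0 !oddD; case: (odd l); case: (odd i).
- rewrite /vedge; case: insubP => [j _ jE|ge_m].
    rewrite mem_FPL_of //= jE chE // sum_forward_bool !oddD /= -jE.
    by case: (v _ _ _); case: (odd l); case: (odd i); case: (odd j).
  (* The chaining edge below column i is read in row i of the previous matrix. *)
  have -> : m.+1 = n by (have := ltn_ord i; lia).
  by rewrite chainE vn addnC.
Qed.

(** With p the parity of i + j at an interior vertex, the right and bottom bits are
flipped by p and the left and top bits by its negation. For either p, having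
exactly two edges present amounts to left + top = right + bottom for the bits. *)
Lemma encodes_ice_states (k_even : ~~ odd k) F h v : encodes F h v ->
  ice_states h v <->
  FPL_boundary F /\ (forall x : vertex k, interior n x -> degree F x = 2%N).
Proof.
case=> hE vE.
have deg2E l (i j : 'I_n) : (degree F (l, i.+1, j.+1) == 2%N)
    = (h l i j.+1 + v l j i.+1 == h l i j + v l j i)%N.
  have [lt_in lt_jn] := (ltn_ord i, ltn_ord j).
  rewrite degree_interior // (hE l i j (ltnW lt_jn)) (hE l i _ lt_jn).
  rewrite (vE l j i (ltnW lt_in)) (vE l j _ lt_in) /= !oddD /=.
  by case: (h l i j); case: (h l i _); case: (v l j i); case: (v l j _);
    case: (odd i); case: (odd j).
split=> [[h0 v0 _ hv]|[[left_F top_F] deg_F]].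
  split; first split=> [l i | l j].
  - by have := hE l i 0%N (leq0n _); rewrite h0 addn0.
  - by have := vE l j 0%N (leq0n _); rewrite v0.
  case=> -[l [|i]] [|j] //=; rewrite ?andbF // => /andP[lt_in lt_jn].
  exact/eqP/(etrans (deg2E l (Ordinal lt_in) (Ordinal lt_jn)))/eqP.
split=> [l i | l j | l j | l i j].
- have := hE l i 0%N (leq0n _); rewrite left_F addn0.
  by case: (h l i 0%N) => //=; case: (odd i).
- have := vE l j 0%N (leq0n _); rewrite top_F add0n.
  by case: (v l j 0%N) => //=; case: (odd j).
- apply: (can_inj (addbK (odd (n + j).+1))); rewrite -vE // vedge_chain hE //.
  by rewrite addnC.
- by apply/eqP; rewrite -deg2E deg_F //= !ltn_ord.
Qed.

End Edges.

Theorem theorem4p23 (n k : nat) (n_gt0 : (0 < n)%N) (k_gt0 : (0 < k)%N)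
    (k_even : ~~ odd k) (F : {set edge k n}) :
  chained_FPL F <->
  FPL_boundary F /\ (forall v : vertex k, interior n v -> degree F v = 2%N).
Proof.
split=> [[A /(chained_ASM_saturated k_even)/saturated_sums[[h v] ice sumA] ->] |].
  exact/(encodes_ice_states k_even (encodes_FPL k_even ice sumA)).
pose h l (i : 'I_n) m := (hedge l i m \in F) (+) odd (i + m).+1.
pose v l (j : 'I_n) m := (vedge l j m \in F) (+) odd (m + j).+1.
have encF : encodes F h v by split=> *; rewrite addbK.
move=> /(encodes_ice_states k_even encF) ice.
have [A sumA satA] := ice_states_saturated ice.
exists A; first exact/chained_ASM_saturated.
exact: encodes_inj encF (encodes_FPL k_even ice sumA).
Qed.
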